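(* Let $n \in \mathbb{N}$ and let $a_1,\ldots,a_n >0$ be such that $\frac{1}{a_1} + \cdots + \frac{1}{a_n} = 1$. Then the following assertions hold: (a) The simplex $\operatorname{conv} \{o, a_1 e_1,\ldots,a_n e_n \}$ has the unique-lifting property. (b) The cross-polytope $\operatorname{conv} \{ \pm \frac{a_1}{2} e_1,\ldots, \pm \frac{a_n}{2} e_n \} + (\frac{1}{2},\ldots, \frac{1}{2})$ has the unique-lifting property.
   Context: $o$ is the origin and $e_1,\dots,e_n$ are the standard unit vectors of $\mathbb{R}^n$. A set $B\subseteq\mathbb{R}^n$ is lattice-free if it is $n$-dimensional, closed, convex and $\operatorname{int}(B)\cap\mathbb{Z}^n=\emptyset$; it is maximal lattice-free if it is inclusion-maximal among lattice-free sets. For $f\in\mathbb{R}^n\setminus\mathbb{Z}^n$, a cut-generating pair for $f$ is a pair of nonnegative functions $\psi,\pi:\mathbb{R}^n\to\mathbb{R}$ such that for all integers $k,\ell\ge 0$, not both zero, and all matrices $R\in\mathbb{R}^{n\times k}$ with columns $r_1,\dots,r_k$ and $P\in\mathbb{R}^{n\times \ell}$ with columns $p_1,\dots,p_\ell$, the inequality $\sum_{i=1}^k\psi(r_i)s_i+\sum_{j=1}^\ell\pi(p_j)y_j\ge 1$ holds for every $(s,y)\in\mathbb{R}_+^k\times\mathbb{Z}_+^\ell$ with $f+Rs+Py\in\mathbb{Z}^n$. In this case $\pi$ is called a lifting of $\psi$. A minimal lifting is a lifting $\pi$ of $\psi$ such that no other, distinct lifting $\pi'$ of $\psi$ satisfies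 $\pi'\le\pi$ pointwise. For $f\in\operatorname{int}(B)$, the gauge function of $B-f$ is $\phi_{B-f}(r)=\inf\{\rho>0: r/\rho\in B-f\}$. A polytope $B$ has the unique-lifting property if it is maximal lattice-free and for every (equivalently, for some) $f\in\operatorname{int}(B)$ the function $\phi_{B-f}$ has exactly one minimal lifting. Known characterization from earlier literature, used by the paper as a working description: for a maximal lattice-free polytope $B$ and $f\in\operatorname{int}(B)$, $\phi_{B-f}$ has exactly one minimal lifting if and only if $R(B,f)+\mathbb{Z}^n=\mathbb{R}^n$, where $R(B,f)=\bigcup_{F}\bigcup_{z\in F\cap\mathbb{Z}^n}\bigl[\operatorname{conv}(\{f\}\cup F)\cap(z+f-\operatorname{conv}(\{f\}\cup F))\bigr]$, with $F$ ranging over all faces of $B$ other than $\emptyset$ and $B$. *)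

(* Defs.v *)
From HB Require Import structures.
From mathcomp Require Import all_boot all_order all_algebra.
From mathcomp Require Import all_classical all_reals all_analysis.

Set Implicit Arguments.
Unset Strict Implicit.
Unset Printing Implicit Defensive.

Import Order.TTheory GRing.Theory Num.Theory.
Import numFieldNormedType.Exports.

Local Open Scope classical_set_scope.
Local Open Scope ring_scope.

Section LatticeFree.
Variables (R : realType) (n : nat).
Implicit Types (A B : set 'cV[R]_n) (f : 'cV[R]_n) (psi pi : 'cV[R]_n -> R).

Definition integer_lattice : set 'cV[R]_n := [set v | v \is a mxOver Num.int].

Definition convex_hull A : set 'cV[R]_n := smallest (@convex_set R 'cV[R]_n) A.

Definition affine_hull A : set 'cV[R]_n :=
  [set x | exists (m : nat) (p : 'I_m -> 'cV[R]_n) (c : 'I_m -> R),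
     [/\ forall i, A (p i), \sum_i c i = 1 & x = \sum_i c i *: p i]].

Definition full_dimensional A : Prop := affine_hull A = setT.

Definition polytope A : Prop :=
  exists2 V : set 'cV[R]_n, finite_set V & A = convex_hull V.

Definition lattice_free B : Prop :=
  [/\ full_dimensional B, closed B, @convex_set R 'cV[R]_n B &
      B° `&` integer_lattice = set0].

Definition maximal_lattice_free B : Prop :=
  lattice_free B /\
  forall B' : set 'cV[R]_n, lattice_free B' -> B `<=` B' -> B' = B.

(* [inf] is 0 on an empty set; below, C is a neighbourhood of the origin, so
   the set of admissible rho is never empty. *)
Definition gauge_function (C : set 'cV[R]_n) (r : 'cV[R]_n) : R :=
  inf [set rho | 0 < rho /\ C (rho^-1 *: r)].

Definition cut_generating_pair f psi pi : Prop :=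
  [/\ ~ integer_lattice f,
      forall r, 0 <= psi r,
      forall r, 0 <= pi r &
      forall (k l : nat), (0 < k + l)%N ->
      forall (Rm : 'M[R]_(n, k)) (Pm : 'M[R]_(n, l))
             (s : 'cV[R]_k) (y : 'cV[nat]_l),
        (forall i, 0 <= s i 0) ->
        integer_lattice
          (f + Rm *m s + Pm *m map_mx (fun m : nat => m%:R : R) y) ->
        1 <= \sum_(i < k) psi (col i Rm) * s i 0
             + \sum_(j < l) pi (col j Pm) * (y j ord0)%:R].

Definition minimal_lifting f psi pi : Prop :=
  cut_generating_pair f psi pi /\
  ~ exists pi' : 'cV[R]_n -> R,
      [/\ cut_generating_pair f psi pi', pi' <> pi & forall r, pi' r <= pi r].

Definition unique_lifting_property B : Prop :=
  [/\ polytope B, maximal_lattice_free B &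
      forall f, B° f ->
        exists! pi : 'cV[R]_n -> R,
          minimal_lifting f (gauge_function [set x - f | x in B]) pi].

Definition unit_vec (i : 'I_n) : 'cV[R]_n := delta_mx i 0.

End LatticeFree.

(* Main.v *)
Require Import Defs.
From mathcomp Require Import all_boot all_order all_algebra.
From mathcomp Require Import all_classical all_reals all_analysis.
From mathcomp Require Import interval_inference ring lra zify.
Import Order.TTheory GRing.Theory Num.Theory.
Import numFieldNormedType.Exports.
Local Open Scope classical_set_scope.
Local Open Scope ring_scope.

Set Implicit Arguments.
Unset Strict Implicit.
Unset Printing Implicit Defensive.

(** Let phi be the gauge of B - f.  A lifting pi of phi must satisfy
    pi(r) >= 1 - phi(z - f - r) for every lattice point z, because f plus
    z - f - r plus r is z.  Suppose that for each r there are lattice vectors w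
    and z and a number t in [0, 1] with r + w in t (B - f) and
    z - f - (r + w) in (1 - t) (B - f) ([spindle_covering]).  Then every lifting
    is at least phi(r + w) at r.  Conversely r |-> phi(r + w(r)) is a lifting,
    since phi is sublinear, is at least 1 at lattice points shifted by f, and
    integer variables may be shifted along the lattice.  So there is a least
    lifting, which is the unique minimal one
    ([unique_minimal_lifting_of_covering]).

    For both bodies the covering is obtained directly, for every f, by letting t
    run over [0, 1] and following the coordinates x_i = r_i + t f_i modulo 1,
    with the weights 1 / a_i, whose sum is 1.  For the simplex it is enough
    that the weighted sum of the fractional parts of the x_i equals t; this sum
    has values in [0, 1[ and the diagonal crosses it, possibly at a jump, where
    the fractional parts 0 and 1 are both available and provide the two
    inequalities that are needed ([floor_ceil_crossing],
    [std_simplex_covering]).  For the cross-polytope it is enough that the weighted sum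
    of the distances of 2 x_i - t to the even integers equals t; that sum is
    continuous with values in [0, 1], so the intermediate value theorem applies
    ([std_cross_covering]).

    Maximality is the blocking argument: each facet has a lattice point in its
    relative interior, which becomes interior as soon as a point beyond the
    facet is added ([maximal_lattice_free_blocked]).  All of this is carried out
    on descriptions of the two hulls by inequalities ([std_simplexE],
    [std_crossE]). *)

(** * Interiors of convex sets *)

Section Interior.
Variables (R : realType) (V : normedModType R).
Implicit Types (A B : set V) (x y c v : V).

(** Turns membership in the interior into a single displacement in a chosen
    direction; for a suitable direction this makes an inequality that defines the
    body strict at [x]. *)
Lemma interior_push A x v : A° x -> exists2 d : R, 0 < d & A (x + d *: v).
Proof.
move=> Ax.
have : x + d *: v @[d --> (0 : R)] --> x + 0 *: v.
  by apply: cvgD; [exact: cvg_cst | apply: cvgZr_tmp; exact: cvg_id].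
rewrite scale0r addr0 => /(_ _ Ax) /nbhs_ballP[e /= e0 He].
exists (e / 2); first by rewrite divr_gt0.
apply: He; rewrite -ball_normE /= sub0r normrN gtr0_norm ?divr_gt0//.
by rewrite ltr_pdivrMr// ltr_pMr// ltr1n.
Qed.

(** The homothety with centre [x] and ratio [1 - rho] carries a neighbourhood of
    [c] inside [B] to a neighbourhood of the point of the segment. *)
Lemma interior_segment B c x (rho : R) :
  (forall y y' (t : R), B y -> B y' -> 0 <= t <= 1 -> B (t *: y + (1 - t) *: y')) ->
  B° c -> B x -> 0 <= rho < 1 -> B° ((1 - rho) *: c + rho *: x).
Proof.
move=> cB Bc Bx /andP[r0 r1].
have d0 : 1 - rho != 0 by rewrite subr_eq0 gt_eqF.
pose g y := (1 - rho)^-1 *: (y - rho *: x).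
have gc : continuous g.
  by move=> y; apply: cvgZl_tmp; apply: cvgB; [exact: cvg_id | exact: cvg_cst].
have := gc ((1 - rho) *: c + rho *: x).
rewrite /continuous_at {2}/g addrK scalerA mulVf// scale1r => /(_ _ Bc).
rewrite nbhs_simpl => gB.
apply: (@filterS _ _ (nbhs_filter ((1 - rho) *: c + rho *: x)) _ _ _ gB).
move=> y /= By.
have -> : y = (1 - rho) *: g y + (1 - (1 - rho)) *: x.
  by rewrite /g scalerA divff// scale1r subKr subrK.
by apply: cB => //; apply/andP; split; lra.
Qed.

End Interior.

(** * Convex hulls, dimension and maximality *)

Section Convexity.
Variables (R : realType) (n : nat).
Implicit Types (A B : set 'cV[R]_n) (x y v : 'cV[R]_n).

(** Trades the barycentric operator on bundled coefficients for plain scalars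
    with bounds. *)
Lemma convex_setP A : @convex_set R 'cV[R]_n A <->
  forall x y t, A x -> A y -> 0 <= t <= 1 -> A (t *: x + (1 - t) *: y).
Proof.
split=> [cA x y t Ax Ay /andP[t0 t1]|cA x y l].
  by have := cA x y (Itv01 t0 t1); rewrite !inE; apply.
rewrite !inE => Ax Ay; apply: (cA x y l%:num) => //.
by rewrite ge0 le1.
Qed.

Lemma convex_hull_convex A : @convex_set R 'cV[R]_n (convex_hull A).
Proof.
apply/convex_setP => x y t hx hy t01 C [cC AC].
by apply: ((convex_setP C).1 cC) => //; [apply: hx | apply: hy].
Qed.

(** With the origin in [A], the missing weight is given to the origin, so the
    coefficients need only sum to at most one.  This matches the way both hulls
    below contain the origin. *)
Lemma convex_sub_sum (I : Type) (s : seq I) A (c : I -> R) (p : I -> 'cV[R]_n) :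
  @convex_set R 'cV[R]_n A -> A 0 ->
  (forall i, 0 <= c i) -> (forall i, A (p i)) ->
  \sum_(i <- s) c i <= 1 -> A (\sum_(i <- s) c i *: p i).
Proof.
move=> /convex_setP cA A0 c0 Ap.
elim: s c c0 => [|i s IH] c c0; first by rewrite !big_nil.
rewrite !big_cons => c1.
have s0 : 0 <= \sum_(j <- s) c j by apply: sumr_ge0.
have := c0 i; have [ci1 _|ci1 ci0] := leP 1 (c i).
  have s00 : \sum_(j <- s) c j = 0 by apply/eqP; rewrite eq_le s0 andbT; lra.
  have -> : c i = 1 by apply/eqP; rewrite eq_le ci1 andbT; lra.
  suff -> : \sum_(j <- s) c j *: p j = 0 by rewrite scale1r addr0.
  elim: s s00 {IH c1 s0} => [|j s IH]; rewrite ?big_nil// !big_cons => /eqP.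
  rewrite paddr_eq0 ?sumr_ge0// => /andP[/eqP -> /eqP/IH ->].
  by rewrite scale0r addr0.
have d0 : 0 < 1 - c i by lra.
have -> : \sum_(j <- s) c j *: p j =
    (1 - c i) *: \sum_(j <- s) (c j / (1 - c i)) *: p j.
  rewrite scaler_sumr; apply: eq_bigr => j _.
  by rewrite scalerA mulrCA divff ?mulr1// gt_eqF.
apply: cA => //; last by rewrite ci0 ltW.
apply: IH => [j|]; first by rewrite divr_ge0// ltW.
by rewrite -mulr_suml ler_pdivrMr// mul1r; lra.
Qed.

Lemma convex_hull_translate A v :
  [set x + v | x in convex_hull A] = convex_hull [set x + v | x in A].
Proof.
have tr C w : @convex_set R 'cV[R]_n C -> @convex_set R 'cV[R]_n [set x | C (x + w)].
  move=> /convex_setP cC; apply/convex_setP => x y t Cx Cy t01 /=.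
  have -> : t *: x + (1 - t) *: y + w = t *: (x + w) + (1 - t) *: (y + w).
    by rewrite !scalerDr addrACA -[t *: w + _]scalerDl subrKC scale1r.
  exact: cC.
apply/seteqP; split=> [_ [x hx <-]|x hx].
  have := smallest_sub (tr _ v (@convex_hull_convex [set x + v | x in A])).
  apply; last exact: hx.
  by move=> y Ay /=; apply: sub_gen_smallest; exists y.
exists (x - v); last by rewrite subrK.
have := smallest_sub (tr _ (- v) (@convex_hull_convex A)).
apply; last exact: hx.
by move=> _ [y Ay <-] /=; rewrite addrK; apply: sub_gen_smallest.
Qed.

(** Each point [x] is on the line through [c] and a point of [B] slightly
    displaced from [c] towards [x]. *)
Lemma full_dimensional_interior B c : B° c -> full_dimensional B.
Proof.
move=> Bc; apply/seteqP; split=> // x _.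
have [d d0 Bd] := interior_push (x - c) Bc.
have Bc' : B c by exact: interior_subset.
exists 2%N, (fun i : 'I_2 => if i == 0 then c else c + d *: (x - c)),
  (fun i : 'I_2 => if i == 0 then 1 - d^-1 else d^-1); split.
- by move=> i; case: ifP.
- by rewrite !big_ord_recl big_ord0 /= addr0 subrK.
- rewrite !big_ord_recl big_ord0 /= addr0 scalerDr scalerA mulVf ?gt_eqF//.
  by rewrite scale1r scalerBl scale1r addrA subrK addrC subrK.
Qed.

(** The blocking criterion: the vector [(M *: z - x) / (M - 1)] lies on the line
    from [x] through [z], slightly beyond [z].  If it is interior to [B], then in
    any convex set containing [B] and [x] the lattice point [z] becomes interior,
    being strictly between that vector and [x]. *)
Lemma maximal_lattice_free_blocked B : lattice_free B ->
  (forall x, ~ B x -> exists z (M : R), [/\ integer_lattice z, 1 < M &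
     B° ((M - 1)^-1 *: (M *: z - x))]) ->
  maximal_lattice_free B.
Proof.
move=> lfB blk; split=> // B' [_ _ cB' iB'] BB'.
apply/seteqP; split=> // x B'x; apply: contrapT => /blk[z [M [zZ M1 Bc]]].
have M0 : 0 < M by exact: lt_trans M1.
have Mn0 : M != 0 by rewrite gt_eqF.
have M10 : M - 1 != 0 by rewrite subr_eq0 gt_eqF.
have : B'° ((1 - M^-1) *: ((M - 1)^-1 *: (M *: z - x)) + M^-1 *: x).
  apply: interior_segment => //; [exact/convex_setP | |].
    exact: (interiorS BB').
  by rewrite invr_ge0 ltW//= invf_lt1.
have -> : (1 - M^-1) *: ((M - 1)^-1 *: (M *: z - x)) + M^-1 *: x = z.
  have -> : 1 - M^-1 = M^-1 * (M - 1) by rewrite mulrBr mulVf// mulr1.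
  by rewrite scalerA mulfK// scalerBr subrK scalerA mulVf// scale1r.
by move=> B'z; have : (B'° `&` @integer_lattice R n) z by []; rewrite iB'.
Qed.

End Convexity.

(** * Integer vectors *)

Section Lattice.
Variables (R : realType) (n : nat).
Implicit Types v w : 'cV[R]_n.

Lemma integer_latticeP v : integer_lattice v <-> forall i, v i 0 \is a Num.int.
Proof.
split=> [/mxOverP vZ i|vZ]; first exact: vZ.
by apply/mxOverP => i j; rewrite ord1.
Qed.

Lemma latticeD v w :
  integer_lattice v -> integer_lattice w -> integer_lattice (v + w).
Proof.
move=> /integer_latticeP vZ /integer_latticeP wZ; apply/integer_latticeP => i.
by rewrite mxE rpredD.
Qed.

Lemma latticeB v w :
  integer_lattice v -> integer_lattice w -> integer_lattice (v - w).
Proof.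
move=> /integer_latticeP vZ /integer_latticeP wZ; apply/integer_latticeP => i.
by rewrite !mxE rpredB.
Qed.

Lemma lattice_sum_nat (I : Type) (s : seq I) (m : I -> nat) (v : I -> 'cV[R]_n) :
  (forall i, integer_lattice (v i)) ->
  integer_lattice (\sum_(i <- s) (m i)%:R *: v i).
Proof.
move=> vZ; apply/integer_latticeP => i; rewrite summxE rpred_sum// => j _.
by rewrite mxE rpredM ?rpred_nat//; exact: (integer_latticeP _).1.
Qed.

End Lattice.

(** * Gauges and liftings *)

Section Lifting.
Variables (R : realType) (n : nat) (B : set 'cV[R]_n) (f : 'cV[R]_n).
Hypotheses (cB : @convex_set R 'cV[R]_n B) (Bf : B° f).
Implicit Types (r v w x z : 'cV[R]_n).

Local Notation gauge := (gauge_function [set x - f | x in B]).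

Let Bf' : B f. Proof. exact: interior_subset. Qed.

(** Guarantees that the infimum defining the gauge is a genuine one. *)
Lemma gauge_set_neq0 r : [set rho : R | 0 < rho /\
  [set x - f | x in B] (rho^-1 *: r)] !=set0.
Proof.
have [d d0 Bd] := interior_push r Bf.
exists d^-1; split; first by rewrite invr_gt0.
by exists (f + d *: r) => //; rewrite invrK addrC addKr.
Qed.

Lemma gauge_set_lb r : lbound [set rho : R | 0 < rho /\
  [set x - f | x in B] (rho^-1 *: r)] 0.
Proof. by move=> rho [/ltW]. Qed.

Lemma gauge_ge0 r : 0 <= gauge r.
Proof. apply: lb_le_inf; [exact: gauge_set_neq0|exact: gauge_set_lb]. Qed.

Lemma gauge_le x t : 0 <= t -> B x -> gauge (t *: (x - f)) <= t.
Proof.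
move=> t0 Bx; apply/ler_addgt0Pr => e e0.
have te : 0 < t + e by rewrite ltr_wpDl.
apply: ge_inf; first by exists 0; exact: gauge_set_lb.
split=> //; exists (t / (t + e) *: x + (1 - t / (t + e)) *: f).
  apply: (convex_setP B).1 => //.
  by rewrite divr_ge0 ?(ltW te)//= ler_pdivrMr// mul1r lerDl ltW.
rewrite scalerBl scale1r addrCA addrAC subrr add0r -scalerBr scalerA.
by rewrite [in RHS]mulrC.
Qed.

(** Together with [gauge_le], this replaces the infimum by a membership: below any
    [t] exceeding the gauge of [r], the vector [r] is in the dilate of [B - f] by
    exactly [t], since dilates of a convex set around [f] increase with the
    factor. *)
Lemma gauge_lt r t : gauge r < t -> exists2 x, B x & r = t *: (x - f).
Proof.
move=> rt; have t0 : 0 < t by apply: le_lt_trans rt; exact: gauge_ge0.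
have [rho [rho0 [x Bx xr]] rhot] := inf_lt (gauge_set_neq0 r) rt.
exists (rho / t *: x + (1 - rho / t) *: f).
  apply: (convex_setP B).1 => //.
  by rewrite divr_ge0 ?ltW//= ltr_pdivrMr// mul1r.
rewrite scalerBl scale1r addrCA addrAC subrr add0r -scalerBr scalerA.
rewrite mulrCA divff ?gt_eqF// mulr1 xr scalerA divff ?gt_eqF//.
by rewrite scale1r.
Qed.

Lemma gaugeD r v : gauge (r + v) <= gauge r + gauge v.
Proof.
apply/ler_addgt0Pr => e e0; have e2 : 0 < e / 2 by rewrite divr_gt0.
have [x Bx rx] : exists2 x, B x & r = (gauge r + e / 2) *: (x - f).
  by apply: gauge_lt; rewrite ltrDl.
have [y By vy] : exists2 x, B x & v = (gauge v + e / 2) *: (x - f).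
  by apply: gauge_lt; rewrite ltrDl.
have := gauge_ge0 r; have := gauge_ge0 v.
move: (gauge r) (gauge v) rx vy => s t rx vy t0 s0.
have se0 : 0 < s + e / 2 by rewrite ltr_wpDl.
have te0 : 0 < t + e / 2 by rewrite ltr_wpDl.
have -> : s + t + e = (s + e / 2) + (t + e / 2) by field.
move: (s + e / 2) (t + e / 2) rx vy se0 te0 => {t0 s0}s' t' -> -> s0 t0.
have st0 : 0 < s' + t' by exact: addr_gt0.
have -> : s' *: (x - f) + t' *: (y - f) = (s' + t') *:
    ((s' / (s' + t') *: x + (1 - s' / (s' + t')) *: y) - f).
  by apply/matrixP => i j; rewrite !mxE; field; rewrite gt_eqF.
apply: gauge_le; first exact: ltW.
apply: (convex_setP B).1 => //.
by rewrite divr_ge0 ?ltW//= ltr_pdivrMr// mul1r ltrDl.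
Qed.

Lemma gaugeZ_le (c : R) r : 0 <= c -> gauge (c *: r) <= gauge r * c.
Proof.
move=> c0; apply/ler_addgt0Pr => e e0; have c1 : 0 < c + 1 by rewrite ltr_wpDl.
have e1 : 0 < e / (c + 1) by rewrite divr_gt0.
have [x Bx rx] : exists2 x, B x & r = (gauge r + e / (c + 1)) *: (x - f).
  by apply: gauge_lt; rewrite ltrDl.
have -> : c *: r = c * (gauge r + e / (c + 1)) *: (x - f).
  by rewrite [in LHS]rx scalerA.
apply: le_trans (gauge_le _ Bx) _.
  by rewrite mulr_ge0// addr_ge0 ?gauge_ge0// ltW.
rewrite mulrDr [c * gauge r]mulrC lerD2l mulrCA ler_piMr// ?ltW//.
by rewrite ltr_pdivrMr// mul1r ltrDl.
Qed.

Lemma gauge_sum (I : Type) (s : seq I) (c : I -> R) (v : I -> 'cV[R]_n) :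
  (forall i, 0 <= c i) ->
  gauge (\sum_(i <- s) c i *: v i) <= \sum_(i <- s) gauge (v i) * c i.
Proof.
move=> c0; elim: s => [|i s IH].
  by rewrite !big_nil; have := gauge_le (lexx 0) Bf'; rewrite scale0r.
rewrite !big_cons; apply: le_trans (gaugeD _ _) _.
by apply: lerD IH; exact: gaugeZ_le.
Qed.

(** A gauge smaller than one puts [x] strictly between [f] and a point of [B]. *)
Lemma gauge_ge1 x : ~ B° x -> 1 <= gauge (x - f).
Proof.
move=> Bx; rewrite leNgt; apply/negP => /[dup] /midf_lt[].
set t := _ / 2 => gt t1 _; apply: Bx.
have [y By /(canRL (subrK _)) ->] := gauge_lt gt.
have -> : t *: (y - f) + f = (1 - t) *: f + t *: y.
  by rewrite scalerBr scalerBl scale1r addrAC [RHS]addrAC [f + _]addrC addrAC.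
apply: interior_segment => //; first exact/convex_setP.
by rewrite t1 andbT; apply: ltW (le_lt_trans (gauge_ge0 _) gt).
Qed.

(** The covering condition R(B,f) + Z^n = R^n, unfolded.  A vector [r + w] is in
    the spindle of a lattice point [z] when [r + w] and [z - f - (r + w)] belong
    to [B - f] scaled by [t] and [1 - t]; adding the multiples [t *: f] and
    [(1 - t) *: f] turns these into dilates of [B] itself, with [u] the
    translated vector. *)
Definition spindle_covering := forall r, exists (t : R) u w z,
  [/\ 0 <= t <= 1, integer_lattice w, integer_lattice z, u = r + w + t *: f &
   [set t *: x | x in B] u /\ [set (1 - t) *: x | x in B] (z - u)].

Lemma mulmx_sum_col (k : nat) (M : 'M[R]_(n, k)) (s : 'cV[R]_k) :
  M *m s = \sum_i s i 0 *: col i M.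
Proof.
apply/matrixP => i j; rewrite mxE summxE; apply: eq_bigr => l _.
by rewrite !mxE ord1 mulrC.
Qed.

Hypothesis iB : B° `&` @integer_lattice R n = set0.

Lemma gauge_lattice_ge1 z : integer_lattice z -> 1 <= gauge (z - f).
Proof.
move=> zZ; apply: gauge_ge1 => Bz.
by have : (B° `&` @integer_lattice R n) z by []; rewrite iB.
Qed.

(** Shifting the columns of [Pm] by lattice vectors changes the point
    [f + Rm *m s + Pm *m y] by a lattice vector, because [y] is integral.  The
    gauge of its new displacement from [f] is at least 1, and sublinearity bounds
    it by the left-hand side of the inequality. *)
Lemma lifting_translate (w : 'cV[R]_n -> 'cV[R]_n) :
  (forall r, integer_lattice (w r)) ->
  cut_generating_pair f gauge (fun r => gauge (r + w r)).
Proof.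
move=> wZ; split=> [fZ|||k l kl Rm Pm s y s0 latP].
- by have : (B° `&` @integer_lattice R n) f by []; rewrite iB.
- exact: gauge_ge0.
- by move=> r; exact: gauge_ge0.
pose yR : 'cV[R]_l := map_mx (fun m : nat => m%:R : R) y.
pose v := Rm *m s + \sum_j yR j 0 *: (col j Pm + w (col j Pm)).
have fv : integer_lattice (f + v).
  have -> : f + v = f + Rm *m s + Pm *m yR + \sum_j yR j 0 *: w (col j Pm).
    rewrite /v mulmx_sum_col (mulmx_sum_col Pm) -!addrA -big_split /=.
    by congr (_ + (_ + _)); apply: eq_bigr => j _; rewrite scalerDr.
  apply: latticeD => //.
  under eq_bigr do rewrite mxE; exact: lattice_sum_nat.
have := gauge_lattice_ge1 fv; rewrite addrC addKr => /le_trans; apply.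
apply: le_trans (gaugeD _ _) _; apply: lerD.
  by rewrite mulmx_sum_col; exact: gauge_sum.
apply: le_trans (gauge_sum _ _ _) _ => [j|]; first by rewrite mxE ler0n.
by apply: ler_sum => j _; rewrite mxE.
Qed.

(** Testing the inequality of the pair on the single relation
    [f + (z - w - f - r) + r = z - w] gives [pi r >= 1 - gauge (z - w - f - r)],
    and the two dilates make the right-hand side at least [t], hence at least
    [gauge (r + w)]. *)
Lemma lifting_ge r t u w z (pi : 'cV[R]_n -> R) :
  0 <= t <= 1 -> integer_lattice w -> integer_lattice z ->
  u = r + w + t *: f ->
  [set t *: x | x in B] u -> [set (1 - t) *: x | x in B] (z - u) ->
  cut_generating_pair f gauge pi -> gauge (r + w) <= pi r.
Proof.
move=> /andP[t0 t1] wZ zZ -> [x Bx xu] [y By yu] [_ _ _ valid].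
have rw : r + w = t *: (x - f) by rewrite scalerBr xu addrK.
have zrw : z - w - f - r = (1 - t) *: (y - f).
  rewrite scalerBr yu [(1 - t) *: f]scalerBl scale1r.
  by apply/matrixP => i j; rewrite !mxE; ring.
rewrite rw; apply: le_trans (gauge_le t0 Bx) _.
have col1 (v : 'cV[R]_n) : col ord0 v = v.
  by apply/matrixP => i j; rewrite !mxE (ord1 j).
have mul1 (v : 'cV[R]_n) : v *m const_mx 1 = v.
  apply/matrixP => i j; rewrite !mxE big_ord_recl big_ord0 !mxE mulr1 addr0.
  by rewrite (ord1 j).
have := valid 1%N 1%N isT (z - w - f - r) r (const_mx 1) (const_mx 1%N).
rewrite !big_ord_recl !big_ord0 !addr0 !mxE !mulr1 !col1 map_const_mx !mul1.
have -> : f + (z - w - f - r) + r = z - w.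
  by rewrite -addrA subrK addrC subrK.
move=> H.
have t10 : 0 <= 1 - t by rewrite subr_ge0.
have := gauge_le t10 By; rewrite -zrw => ht.
have {}H : 1 <= gauge (z - w - f - r) + pi r.
  by apply: H; [move=> i; rewrite mxE ler01 | exact: latticeB].
rewrite -(lerD2l (1 - t)) subrK; apply: le_trans H _.
by rewrite lerD2r.
Qed.

(** The translates [w r] supplied by the covering define a lifting that is below
    every other lifting, so it is the minimal one. *)
Lemma unique_minimal_lifting_of_covering : spindle_covering ->
  exists! pi : 'cV[R]_n -> R, minimal_lifting f gauge pi.
Proof.
move=> cov.
have [w Hw] : {w : 'cV[R]_n -> 'cV[R]_n & forall r, integer_lattice (w r) /\
    forall pi, cut_generating_pair f gauge pi -> gauge (r + w r) <= pi r}.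
  apply: (choice (P := fun r w => integer_lattice w /\ forall pi,
    cut_generating_pair f gauge pi -> gauge (r + w) <= pi r)) => r.
  have [t [u [w [z [t01 wZ zZ ru [Bu Bzu]]]]]] := cov r.
  by exists w; split=> // pi; apply: lifting_ge t01 wZ zZ ru Bu Bzu.
have cgp := lifting_translate (fun r => (Hw r).1).
exists (fun r => gauge (r + w r)); split=> [|pi [pip pimin]].
  split=> // -[pi [pip pine pile]]; apply: pine; apply/funext => r.
  by apply/eqP; rewrite eq_le pile (Hw r).2.
apply: contrapT => ne; apply: pimin; exists (fun r => gauge (r + w r)).
by split=> // r; exact: (Hw r).2.
Qed.

End Lifting.

(** * Two crossing arguments on the line *)

Lemma continuous_wsum (R : realType) (T : topologicalType) (I : finType)
    (b : I -> R) (g : I -> T -> R) :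
  (forall i, continuous (g i)) -> continuous (fun x => \sum_i b i * g i x).
Proof.
move=> gc; apply: (continuous_big (P := xpredT)) => [|i _ x].
  exact: add_continuous.
by apply: cvgMl_tmp; exact: gc.
Qed.

Section FractionalCrossing.
Variables (R : realType) (I : finType).
Variables (b : I -> R) (x : I -> R -> R).
Hypotheses (b0 : forall i, 0 <= b i) (b1 : \sum_i b i = 1).
Hypothesis xc : forall i, continuous (x i).

(** A discontinuous intermediate value theorem: the weighted sum of the fractional
    parts of the [x i t] lies in [0, 1[, so it meets the diagonal between [t = 0]
    and [t = 1], except that it may jump across the diagonal when some [x i t]
    pass through integers.  At such a jump the two inequalities record the two
    one-sided values, fractional part 0 and fractional part 1. *)
Lemma floor_ceil_crossing : exists2 t : R, 0 <= t <= 1 &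
  \sum_i b i * (x i t - (Num.floor (x i t))%:~R) <= t <=
  \sum_i b i * (x i t - (Num.ceil (x i t))%:~R + 1).
Proof.
(* With the continuous part [X] isolated, what remains is a lower semicontinuous
   [Ce] and an upper semicontinuous [Fl], with [Ce <= Fl], to be placed on the two
   sides of [X]. *)
pose X t := \sum_i b i * x i t - t.
pose Fl t := \sum_i b i * (Num.floor (x i t))%:~R.
pose Ce t := \sum_i b i * ((Num.ceil (x i t))%:~R - 1).
have Xc : continuous X.
  move=> t; apply: cvgB; last exact: cvg_id.
  exact: continuous_wsum.
suff [t t01 /andP[Ct Ft]] : exists2 t : R, 0 <= t <= 1 & Ce t <= X t <= Fl t.
  exists t => //; apply/andP; split.
    under eq_bigr do rewrite mulrBr.
    by rewrite sumrB; move: Ft; rewrite /X /Fl; lra.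
  under eq_bigr do rewrite -addrA [- _ + 1]addrC -opprB mulrBr.
  by rewrite sumrB; move: Ct; rewrite /X /Ce; lra.
pose S := [set t | 0 <= t <= 1 /\ Ce t <= X t].
have S0 : S 0.
  split; first by rewrite lexx ler01.
  rewrite /X subr0; apply: ler_sum => i _; apply: ler_wpM2l => //.
  by have := ceil_itv (x i 0); lra.
have Sub : has_ubound S by exists 1 => t [/andP[]].
have Ssup : has_sup S by split=> //; exists 0.
pose t0 := sup S.
have t00 : 0 <= t0 by exact: sup_upper_bound.
have t01 : t0 <= 1.
  by apply: sup_le_ub => [|t [/andP[]]//]; exists 0.
exists t0; first by rewrite t00 t01.
apply/andP; split.
  (* Near [t0] no ceiling drops below its value at [t0], so the points of [S]
     close to the supremum contradict [X t0 < Ce t0]. *)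
  rewrite leNgt; apply/negP => Xt0.
  have : \forall s \near t0, X s < Ce t0 /\
      forall i, (Num.ceil (x i t0))%:~R - 1 < x i s.
    near=> s; split; near: s.
      by apply: (cvgr_lt _ (Xc t0)).
    apply: filter_forall => i; apply: (cvgr_gt _ (@xc i t0)).
    by have := ceil_itv (x i t0); lra.
  move=> /nbhs_ballP[e /= e0 He].
  have [s Ss es] := sup_adherent e0 Ssup.
  have st0 : s <= t0 by exact: sup_upper_bound.
  have [|Xs xs] := He s.
    by rewrite -ball_normE /= ger0_norm ?subr_ge0// ltrBlDr -ltrBlDl.
  have : Ce t0 <= Ce s.
    apply: ler_sum => i _; apply: ler_wpM2l => //; rewrite lerD2r ler_int.
    have := xs i; rewrite -(intrB _ _ 1) -ceil_gt_int => h.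
    by rewrite -(subrK 1 (Num.ceil (x i t0))) lezD1.
  by case: Ss => _; lra.
(* At [t = 1] the upper bound is free, because fractional parts are below 1. *)
have [/eqP t0E|t01n] := boolP (t0 == 1).
  rewrite /X t0E -{2}b1 -sumrB; apply: ler_sum => i _.
  rewrite -[X in _ - X]mulr1 -mulrBr; apply: ler_wpM2l => //.
  by have := floor_itv (x i 1); rewrite intrD; lra.
(* Near [t0] no ceiling exceeds the floor at [t0] by more than 1, so a point just
   to the right of [t0] would still belong to [S]. *)
rewrite leNgt; apply/negP => Xt0.
have : \forall s \near t0, [/\ s < 1, Fl t0 < X s &
    forall i, x i s < (Num.floor (x i t0) + 1)%:~R].
  near=> s; split; near: s.
  - by apply: (cvgr_lt _ (@cvg_id _ (nbhs t0))); rewrite lt_neqAle t01n.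
  - by apply: (cvgr_gt _ (Xc t0)).
  - apply: filter_forall => i; apply: (cvgr_lt _ (@xc i t0)).
    exact: floorD1_gt.
move=> /nbhs_ballP[e /= e0 He].
have [|s1 Xs xs] := He (t0 + e / 2).
  rewrite -ball_normE /= opprD addNKr normrN gtr0_norm ?divr_gt0//; lra.
have : S (t0 + e / 2).
  split; first by apply/andP; split; lra.
  apply: le_trans (ltW Xs); apply: ler_sum => i _; apply: ler_wpM2l => //.
  by rewrite lerBlDr -intrD1 ler_int ceil_le_int ltW.
by move=> /(sup_upper_bound Ssup); rewrite -/t0; lra.
Unshelve. all: by end_near.
Qed.

End FractionalCrossing.

Section EvenDistance.
Variable R : realType.
Implicit Types y : R.

Definition nearest_even y : R := 2 * (Num.floor ((y + 1) / 2))%:~R.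

Lemma nearest_even_dist y : `|y - nearest_even y| <= 1.
Proof.
rewrite /nearest_even; have := floor_itv ((y + 1) / 2); rewrite intrD.
by move=> h; rewrite ler_norml; apply/andP; split; lra.
Qed.

Lemma nearest_evenP y (m : int) : `|y - nearest_even y| <= `|y - 2 * m%:~R|.
Proof.
have := nearest_even_dist y; rewrite /nearest_even; set k := Num.floor _ => h.
have [->//|km] := eqVneq m k; apply: le_trans h _.
have {}km : (1 : R) <= `|k%:~R - m%:~R|.
  by rewrite -intrB -intr_norm ler1z -gtz0_ge1 normr_gt0 subr_eq0 eq_sym.
have := ler_normB (y - 2 * m%:~R) (y - 2 * k%:~R).
have -> : y - 2 * m%:~R - (y - 2 * k%:~R) = 2 * (k%:~R - m%:~R) by ring.
rewrite normrM (@ger0_norm _ 2)//.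
by have := nearest_even_dist y; rewrite /nearest_even -/k; lra.
Qed.

(** As the distance to a set, it is 1-Lipschitz. *)
Lemma even_distance_continuous : continuous (fun y => `|y - nearest_even y|).
Proof.
have lip y y' : `|y' - nearest_even y'| <= `|y - nearest_even y| + `|y - y'|.
  apply: le_trans (nearest_evenP y' (Num.floor ((y + 1) / 2))) _.
  rewrite -/(nearest_even y) [leRHS]addrC (distrC y y').
  have -> : y' - nearest_even y = (y' - y) + (y - nearest_even y) by ring.
  exact: ler_normD.
move=> y; apply/cvgrPdist_le => e e0; near=> y'.
have ye : `|y - y'| <= e.
  by near: y'; exact: (cvgrPdist_le _ _).1 (@cvg_id _ (nbhs y)) _ e0.
have := lip y y'; have := lip y' y; rewrite [`|y' - y|]distrC => h1 h2.
by rewrite ler_norml; apply/andP; split; lra.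
Unshelve. all: by end_near.
Qed.

End EvenDistance.

(** * The simplex *)

Section Simplex.
Variables (R : realType) (n : nat) (a : 'I_n -> R).
Hypotheses (a_gt0 : forall i, 0 < a i) (a_sum : \sum_(i < n) (a i)^-1 = 1).
Implicit Types u x z f : 'cV[R]_n.

Local Notation wsum x := (\sum_i (a i)^-1 * x i 0).

Let b0 i : 0 < (a i)^-1. Proof. by rewrite invr_gt0. Qed.

Definition std_simplex : set 'cV[R]_n :=
  [set x | (forall i, 0 <= x i 0) /\ wsum x <= 1].

Lemma wsumD x z : wsum (x + z) = wsum x + wsum z.
Proof. by rewrite -big_split; apply: eq_bigr => i _; rewrite mxE mulrDr. Qed.

Lemma wsumZ c x : wsum (c *: x) = c * wsum x.
Proof. by rewrite mulr_sumr; apply: eq_bigr => i _; rewrite mxE mulrCA. Qed.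

Lemma wsumN x : wsum (- x) = - wsum x.
Proof. by rewrite -scaleN1r wsumZ mulN1r. Qed.

Lemma wsum_const c : wsum (const_mx c : 'cV_n) = c.
Proof.
rewrite -[RHS]mul1r -a_sum mulr_suml; apply: eq_bigr => i _.
by rewrite mxE.
Qed.

Lemma std_simplex_convex : @convex_set R 'cV[R]_n std_simplex.
Proof.
apply/convex_setP => x y t [x0 x1] [y0 y1] /andP[t0 t1]; split=> [i|].
  by rewrite !mxE addr_ge0// mulr_ge0// subr_ge0.
rewrite wsumD !wsumZ -[leRHS](subrK t) addrC.
by rewrite lerD// ler_piMr// subr_ge0.
Qed.

Lemma std_simplexE : convex_hull
  ([set 0] `|` [set a i *: unit_vec R i | i in [set: 'I_n]]) = std_simplex.
Proof.
apply/seteqP; split.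
  apply: smallest_sub; first exact: std_simplex_convex.
  move=> x [->|[j _ <-]]; split=> [i|].
  - by rewrite mxE.
  - by have := wsum_const 0; rewrite /const_mx => -> //.
  - by rewrite !mxE mulr_ge0// ?ler0n// ltW.
  - rewrite wsumZ (bigD1 j)//= big1 ?addr0 => [|i ij].
      by rewrite !mxE !eqxx mulr1 divff// gt_eqF.
    by rewrite !mxE (negbTE ij) mulr0.
move=> x [x0 x1].
have -> : x = \sum_i ((a i)^-1 * x i 0) *: (a i *: unit_vec R i).
  apply/matrixP => i j; rewrite summxE (bigD1 i)//= big1 ?addr0 => [|k ki].
    by rewrite !mxE ord1 !eqxx mulr1 mulrAC mulVf ?mul1r// gt_eqF.
  by rewrite !mxE eq_sym (negbTE ki) !mulr0.
apply: convex_sub_sum => //.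
- exact: convex_hull_convex.
- by apply: sub_gen_smallest; left.
- by move=> i; rewrite mulr_ge0// ltW.
- by move=> i; apply: sub_gen_smallest; right; exists i.
Qed.

Lemma std_simplex_interior x : (forall i, 0 < x i 0) -> wsum x < 1 ->
  std_simplex° x.
Proof.
move=> x0 x1.
have wc : continuous (fun y : 'cV[R]_n => wsum y).
  by apply: continuous_wsum => i; exact: coord_continuous.
have pos : nbhs x [set y : 'cV[R]_n | forall i, 0 < y i 0].
  apply: (filter_forall (nbhs_filter x)) => i.
  by apply: (cvgr_gt _ (@coord_continuous _ _ _ i 0 x)).
have lt1 : nbhs x [set y : 'cV[R]_n | wsum y < 1] by apply: (cvgr_lt _ (wc x)).
apply: (@filterS _ _ (nbhs_filter x) _ _ _ (filterI pos lt1)) => y [y0 y1].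
by split=> [i|]; exact: ltW.
Qed.

(** A lattice point in the interior would have all coordinates at least 1, hence
    weighted sum at least 1, while interior points stay below 1. *)
Lemma std_simplex_lattice_free : lattice_free std_simplex.
Proof.
split.
- apply: (@full_dimensional_interior _ _ _ (const_mx 2^-1)).
  apply: std_simplex_interior => [i|]; first by rewrite mxE invr_gt0.
  by rewrite wsum_const invf_lt1// ltr1n.
- have -> : std_simplex = (\bigcap_(i in [set: 'I_n]) [set x | 0 <= x i 0]) `&`
      [set x | wsum x <= 1].
    apply/seteqP; split=> x [x0 x1]; split=> // i; first by move=> _; exact: x0.
    exact: x0.
  apply: closedI.
    apply: closed_bigI => i _.
    by apply: closed_comp (@closed_ge _ 0) => y _; exact: coord_continuous.
  apply: closed_comp (@closed_le _ 1) => y _.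
  by apply: continuous_wsum => i; exact: coord_continuous.
- exact: std_simplex_convex.
- apply/seteqP; split=> // z [Bz /integer_latticeP zZ].
  have z1 i : 1 <= z i 0.
    have [d d0 [/(_ i) + _]] := interior_push (const_mx (-1)) Bz.
    rewrite !mxE mulrN1 subr_ge0 => dz.
    have : 0 < z i 0 by exact: lt_le_trans dz.
    by move: (zZ i) => /intrP[m ->]; rewrite ltr0z ler1z gtz0_ge1.
  have [d d0 [_]] := interior_push (const_mx 1) Bz.
  rewrite wsumD wsumZ wsum_const mulr1 leNgt => /negP; apply.
  apply: (@lt_le_trans _ _ (1 + d)); first by rewrite ltrDl.
  rewrite lerD2r -[leLHS](wsum_const 1); apply: ler_sum => i _.
  by rewrite mxE ler_wpM2l// ltW.
Qed.

(** The all-ones vector is in the relative interior of the slanted facet, and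
    the all-ones vector with coordinate [k] set to 0 is in the relative interior
    of the facet [x k 0 = 0]. *)
Lemma std_simplex_blocked x : ~ std_simplex x ->
  exists z (M : R), [/\ integer_lattice z, 1 < M &
    std_simplex° ((M - 1)^-1 *: (M *: z - x))].
Proof.
move=> Bx.
(* Strict inequalities of the simplex, multiplied by [M - 1]. *)
suff [z [M [zZ M1 zx0 zx1]]] : exists z (M : R), [/\ integer_lattice z, 1 < M,
    forall i, x i 0 < M * z i 0 & M * wsum z - wsum x < M - 1].
  have M10 : 0 < M - 1 by rewrite subr_gt0.
  exists z, M; split=> //; apply: std_simplex_interior => [i|].
    by rewrite !mxE mulr_gt0 ?invr_gt0// subr_gt0.
  by rewrite wsumZ wsumD wsumZ wsumN mulrC ltr_pdivrMr// mul1r.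
pose N := \sum_i `|x i 0|.
have xN i : `|x i 0| <= N.
  by rewrite /N (bigD1 i)//= lerDl sumr_ge0.
have N0 : 0 <= N by exact: sumr_ge0.
have [x1|x1] := ltP 1 (wsum x).
  exists (const_mx 1), (N + 2); split.
  - by apply/integer_latticeP => i; rewrite mxE rpred1.
  - by lra.
  - move=> i; rewrite mxE mulr1.
    by have := xN i; have := ler_norm (x i 0); lra.
  - by rewrite wsum_const; lra.
have [k xk] : exists k, x k 0 < 0.
  apply: contrapT => nx; apply: Bx; split=> // i; rewrite leNgt.
  by apply/negP => xi; apply: nx; exists i.
pose z := const_mx 1 - unit_vec R k.
have zE i : z i 0 = (i != k)%:R.
  by rewrite !mxE eqxx andbT; case: eqP; rewrite ?subrr ?subr0.
have zw : wsum z = 1 - (a k)^-1.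
  rewrite wsumD wsum_const wsumN (bigD1 k)//= big1.
    by rewrite !mxE !eqxx mulr1 addr0.
  by move=> i ik; rewrite !mxE (negbTE ik) mulr0.
(* [N] handles the coordinate inequalities; the last term makes [M / a k] exceed
   [1 - wsum x], the slack needed on the slanted facet. *)
exists z, (N + 2 + a k * (1 + `|wsum x|)); split.
- by apply/integer_latticeP => i; rewrite zE natr_int.
- have : 0 <= a k * (1 + `|wsum x|) by rewrite mulr_ge0 ?addr_ge0// ltW.
  by lra.
- move=> i; rewrite zE; have [->|_] := eqVneq i k; first by rewrite mulr0.
  have : 0 <= a k * (1 + `|wsum x|) by rewrite mulr_ge0 ?addr_ge0// ltW.
  by rewrite mulr1; have := xN i; have := ler_norm (x i 0); lra.
- rewrite zw mulrBr mulr1; set M := N + 2 + _.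
  suff : 1 - wsum x < M / a k by lra.
  rewrite ltr_pdivlMr// mulrC /M.
  have := a_gt0 k; have : - wsum x <= `|wsum x| by rewrite -normrN ler_norm.
  by move=> h ak; have := ler_wpM2l (ltW ak) h; lra.
Qed.

(** Stated on [u] itself so that the degenerate factor [t = 0], where [u] must
    vanish, needs no separate treatment later. *)
Lemma std_simplex_scale u t : 0 <= t -> (forall i, 0 <= u i 0) -> wsum u <= t ->
  [set t *: x | x in std_simplex] u.
Proof.
rewrite le_eqVlt => /predU1P[<- u0 u1|t0 u0 u1].
  exists 0; first by split=> [i|]; rewrite ?mxE// (wsum_const 0).
  apply/matrixP => i j; rewrite !mxE mul0r ord1; apply/esym/eqP.
  have : wsum u == 0 by rewrite eq_le u1 sumr_ge0// => k _; rewrite mulr_ge0// ltW.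
  rewrite psumr_eq0 => [/allP/(_ i)|k _]; last by rewrite mulr_ge0// ltW.
  by rewrite mem_index_enum => /(_ isT); rewrite mulf_eq0 gt_eqF.
exists (t^-1 *: u); last by rewrite scalerA divff ?scale1r// gt_eqF.
split=> [i|]; first by rewrite mxE mulr_ge0// invr_ge0 ltW.
by rewrite wsumZ mulrC ler_pdivrMr// mul1r.
Qed.

(** Take for [u] the vector of fractional parts of [r + t *: f] and for [z] its
    coordinatewise rounding up.  Then [u] and [z - u] are nonnegative, and their
    weighted sums are at most [t] and [1 - t] by the two inequalities of
    [floor_ceil_crossing]. *)
Lemma std_simplex_covering f : spindle_covering std_simplex f.
Proof.
move=> r; pose X i t := r i 0 + t * f i 0.
have [||i|t t01 /andP[tl tu]] := @floor_ceil_crossing R _ (fun i => (a i)^-1) X.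
- by move=> i; rewrite ltW.
- exact: a_sum.
- move=> t; apply: cvgD; first exact: cvg_cst.
  by apply: cvgMr_tmp; exact: cvg_id.
pose w : 'cV[R]_n := \col_i - (Num.floor (X i t))%:~R.
pose z : 'cV[R]_n := \col_i ((Num.ceil (X i t))%:~R - (Num.floor (X i t))%:~R).
exists t, (r + w + t *: f), w, z; split=> //.
- by apply/integer_latticeP => i; rewrite mxE rpredN intr_int.
- by apply/integer_latticeP => i; rewrite mxE rpredB// intr_int.
have [t0 t1] := andP t01.
have uE i : (r + w + t *: f) i 0 = X i t - (Num.floor (X i t))%:~R.
  by rewrite !mxE addrAC.
have zuE i : (z - (r + w + t *: f)) i 0 = 1 - (X i t - (Num.ceil (X i t))%:~R + 1).
  have -> : (z - (r + w + t *: f)) i 0 = z i 0 - (r + w + t *: f) i 0.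
    by rewrite !mxE.
  by rewrite uE mxE; ring.
split; apply: std_simplex_scale => //; rewrite ?subr_ge0//.
- by move=> i; rewrite uE subr_ge0 floor_le.
- by under eq_bigr do rewrite uE.
- move=> i; rewrite zuE opprD addrCA subrr addr0 opprB.
  by rewrite subr_ge0 ceil_ge.
- have -> : wsum (z - (r + w + t *: f)) = 1 -
      \sum_i (a i)^-1 * (X i t - (Num.ceil (X i t))%:~R + 1).
    rewrite -[X in _ = X - _]a_sum -sumrB; apply: eq_bigr => i _.
    by rewrite zuE; ring.
  by rewrite lerD2l lerN2.
Qed.

Lemma simplex_unique_lifting : unique_lifting_property (convex_hull
  ([set 0] `|` [set a i *: unit_vec R i | i in [set: 'I_n]])).
Proof.
have lf := std_simplex_lattice_free.
split.
- exists ([set 0] `|` [set a i *: unit_vec R i | i in [set: 'I_n]]) => //.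
  by rewrite finite_setU; split; [exact: finite_set1 | exact: finite_image].
- rewrite std_simplexE; apply: maximal_lattice_free_blocked => //.
  exact: std_simplex_blocked.
rewrite std_simplexE => f Bf; have [_ _ cB iB] := lf.
apply: unique_minimal_lifting_of_covering => //.
exact: std_simplex_covering.
Qed.

End Simplex.

(** * The cross-polytope *)

Section CrossPolytope.
Variables (R : realType) (n : nat) (a : 'I_n -> R).
Hypotheses (a_gt0 : forall i, 0 < a i) (a_sum : \sum_(i < n) (a i)^-1 = 1).
Implicit Types u x z f : 'cV[R]_n.

Local Notation wabs x := (\sum_i (a i)^-1 * `|2 * x i 0 - 1|).

Let b0 i : 0 < (a i)^-1. Proof. by rewrite invr_gt0. Qed.

Definition std_cross : set 'cV[R]_n := [set x | wabs x <= 1].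

Lemma std_cross_convex : @convex_set R 'cV[R]_n std_cross.
Proof.
apply/convex_setP => x y t; rewrite /std_cross /= => x1 y1 /andP[t0 t1].
have : t * wabs x + (1 - t) * wabs y <= t * 1 + (1 - t) * 1.
  by rewrite lerD// ler_wpM2l// subr_ge0.
rewrite -mulrDl subrKC mulr1 => h; apply: le_trans _ h.
rewrite !mulr_sumr -big_split /=; apply: ler_sum => i _.
rewrite 2!(mulrCA _ (a i)^-1) -mulrDr; apply: ler_wpM2l; first exact: ltW.
rewrite !mxE.
have -> : 2 * (t * x i 0 + (1 - t) * y i 0) - 1 =
  t * (2 * x i 0 - 1) + (1 - t) * (2 * y i 0 - 1) by ring.
apply: le_trans (ler_normD _ _) _; rewrite !normrM.
by rewrite (ger0_norm t0) (@ger0_norm _ (1 - t)) ?subr_ge0.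
Qed.

Local Notation vertices :=
  ([set (a i / 2) *: unit_vec R i | i in [set: 'I_n]] `|`
   [set - (a i / 2) *: unit_vec R i | i in [set: 'I_n]]).

(** A point of the cross-polytope is the combination, with weights
    [|2 x_i - 1| / a_i], of the vertices selected by the signs of [2 x_i - 1]; the
    rest of the weight goes to the centre. *)
Lemma std_crossE : [set x + const_mx 2^-1 | x in convex_hull vertices] = std_cross.
Proof.
apply/seteqP; split; rewrite convex_hull_translate.
  apply: smallest_sub; first exact: std_cross_convex.
  have vert (i : 'I_n) (c : R) : `|c| = a i / 2 ->
      std_cross (c *: unit_vec R i + const_mx 2^-1).
    move=> ca; rewrite /std_cross /= (bigD1 i)//= big1 ?addr0.
      rewrite !mxE !eqxx mulr1 mulrDr mulfV// addrK normrM ca ger0_norm//.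
      by rewrite [2 * _]mulrC divfK// mulVf// gt_eqF.
    move=> j ji; rewrite !mxE (negbTE ji) mulr0 add0r mulfV// subrr.
    by rewrite normr0 mulr0.
  move=> _ [_ [] [i _ <-] <-]; apply: vert; rewrite ?normrN gtr0_norm//;
    by rewrite divr_gt0.
move=> x; rewrite -convex_hull_translate /std_cross /= => x1.
exists (x - const_mx 2^-1); last by rewrite subrK.
pose c i := (a i)^-1 * `|2 * x i 0 - 1|.
pose p i : 'cV[R]_n := (Num.sg (2 * x i 0 - 1) * (a i / 2)) *: unit_vec R i.
have Hv (i : 'I_n) (e : bool) :
    convex_hull vertices ((-1) ^+ e * (a i / 2) *: unit_vec R i).
  apply: sub_gen_smallest; case: e; rewrite ?expr0 ?expr1 ?mul1r ?mulN1r.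
    by right; exists i.
  by left; exists i.
(* The centre is the midpoint of two opposite vertices, which exist because the
   weights sum to 1. *)
have H0 : (0 < n)%N -> convex_hull vertices 0.
  move=> n0; pose i := Ordinal n0.
  have := (convex_setP _).1 (@convex_hull_convex _ _ vertices) _ _ 2^-1
    (Hv i true) (Hv i false).
  have -> : 2^-1 *: ((-1) ^+ true * (a i / 2) *: unit_vec R i) +
      (1 - 2^-1) *: ((-1) ^+ false * (a i / 2) *: unit_vec R i) = 0.
    by apply/matrixP => k l; rewrite !mxE expr0 expr1; field.
  by apply; apply/andP; split; lra.
have n0 : (0 < n)%N.
  case: (n) a a_sum => // a'; rewrite big_ord0 => /esym/eqP.
  by rewrite oner_eq0.
have -> : x - const_mx 2^-1 = \sum_i c i *: p i.
  apply/matrixP => i j; rewrite summxE (bigD1 i)//= big1 ?addr0 => [|k ki].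
    rewrite !mxE ord1 !eqxx mulr1 /c.
    rewrite mulrA -[_ * _ * Num.sg _]mulrA [`|_| * _]mulrC -numEsg.
    by field; rewrite gt_eqF.
  by rewrite !mxE eq_sym (negbTE ki) !mulr0.
apply: convex_sub_sum => //.
- exact: convex_hull_convex.
- exact: H0.
- by move=> i; rewrite mulr_ge0// ltW.
- move=> i; rewrite /p; case: sgrP => _; rewrite ?mul0r ?scale0r; first exact: H0.
    exact: (Hv i false).
  exact: (Hv i true).
Qed.

Lemma wabs_continuous : continuous (fun x => wabs x).
Proof.
apply: (continuous_wsum (g := fun i (x : 'cV[R]_n) => `|2 * x i 0 - 1|)) => i y.
apply: (@continuous_comp _ _ _ (fun x : 'cV[R]_n => x i 0)
  (fun t : R => `|2 * t - 1|)); first exact: coord_continuous.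
apply: cvg_norm; apply: cvgB; last exact: cvg_cst.
by apply: cvgMl_tmp; exact: cvg_id.
Qed.

Lemma std_cross_interior x : wabs x < 1 -> std_cross° x.
Proof.
move=> x1.
have lt1 : nbhs x [set y : 'cV[R]_n | wabs y < 1].
  by apply: (cvgr_lt _ (@wabs_continuous x)).
apply: (@filterS _ _ (nbhs_filter x) _ _ _ lt1) => y; exact: ltW.
Qed.

(** An integer [m] satisfies [|2 m - 1| >= 1], so lattice points have weighted sum
    at least 1; pushing away from the centre would leave the body. *)
Lemma std_cross_lattice_free : lattice_free std_cross.
Proof.
split.
- apply: (@full_dimensional_interior _ _ _ (const_mx 2^-1)).
  apply: std_cross_interior; rewrite big1// => i _.
  by rewrite mxE mulfV// subrr normr0 mulr0.
- apply: closed_comp (@closed_le _ 1) => y _; exact: wabs_continuous.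
- exact: std_cross_convex.
- apply/seteqP; split=> // z [Bz /integer_latticeP zZ].
  have z1 i : 1 <= `|2 * z i 0 - 1|.
    move: (zZ i) => /intrP[m ->].
    have -> : 2 * m%:~R - 1 = (2 * m - 1)%:~R :> R by rewrite intrB intrM.
    by rewrite -intr_norm ler1z -gtz0_ge1 normr_gt0; apply/eqP; lia.
  have [d d0] := interior_push (z - const_mx 2^-1) Bz.
  rewrite /std_cross /= leNgt => /negP; apply.
  have -> : wabs (z + d *: (z - const_mx 2^-1)) = (1 + d) * wabs z.
    rewrite mulr_sumr; apply: eq_bigr => i _; rewrite mulrCA !mxE.
    rewrite -(@gtr0_norm _ (1 + d)) ?addr_gt0// -normrM.
    by congr (_ * `|_|); field.
  apply: (@lt_le_trans _ _ (1 + d)); first by rewrite ltrDl.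
  rewrite ler_peMr ?addr_ge0 ?(ltW d0)//.
  by rewrite -[leLHS]a_sum; apply: ler_sum => i _; rewrite ler_peMr// ltW.
Qed.

(** The facets correspond to sign vectors.  For the signs of [2 x - 1], with 0
    counted as positive, the facet is violated by [x], and the 0/1 point [z] whose
    vector [2 z - 1] consists of these signs is in its relative interior. *)
Lemma std_cross_blocked x : ~ std_cross x ->
  exists z (M : R), [/\ integer_lattice z, 1 < M &
    std_cross° ((M - 1)^-1 *: (M *: z - x))].
Proof.
move=> /negP; rewrite -ltNge => x1.
pose N := \sum_i `|2 * x i 0 - 1|.
have xN i : `|2 * x i 0 - 1| <= N by rewrite /N (bigD1 i)//= lerDl sumr_ge0.
have N0 : 0 <= N by exact: sumr_ge0.
pose z : 'cV[R]_n := \col_i (0 <= 2 * x i 0 - 1)%R%:R.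
exists z, (N + 2); split; [|lra|].
  by apply/integer_latticeP => i; rewrite mxE natr_int.
have M1 : 0 < N + 2 - 1 by lra.
apply: std_cross_interior.
have -> : wabs ((N + 2 - 1)^-1 *: ((N + 2) *: z - x)) =
    (N + 2 - 1)^-1 * (N + 2 - wabs x).
  have -> : N + 2 - wabs x = \sum_i (a i)^-1 * (N + 2 - `|2 * x i 0 - 1|).
    under [RHS]eq_bigr do rewrite mulrBr.
    by rewrite sumrB -mulr_suml a_sum mul1r.
  rewrite mulr_sumr; apply: eq_bigr => i _; rewrite [RHS]mulrCA.
  congr (_ * _); have := xN i; rewrite !mxE; move: (x i 0) => v vN.
  have -> : 2 * ((N + 2 - 1)^-1 * ((N + 2) * (0 <= 2 * v - 1)%R%:R - v)) - 1 =
      (N + 2 - 1)^-1 * ((N + 2) * (2 * (0 <= 2 * v - 1)%R%:R - 1) - (2 * v - 1)).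
    by field; rewrite gt_eqF.
  rewrite normrM gtr0_norm ?invr_gt0//; congr (_ * _).
  have [v0|v0] := leP 0 (2 * v - 1); move: vN.
    by rewrite (ger0_norm v0) mulr1n => vN; rewrite ger0_norm; lra.
  by rewrite (ltr0_norm v0) mulr0n => vN; rewrite ler0_norm; lra.
by rewrite mulrC ltr_pdivrMr// mul1r; lra.
Qed.

Lemma std_cross_scale u t : 0 <= t ->
  \sum_i (a i)^-1 * `|2 * u i 0 - t| <= t -> [set t *: x | x in std_cross] u.
Proof.
rewrite le_eqVlt => /predU1P[<- u1|t0 u1].
  exists (const_mx 2^-1).
    by rewrite /std_cross /= big1// => i _; rewrite mxE mulfV// subrr normr0 mulr0.
  apply/matrixP => i j; rewrite !mxE mul0r ord1; apply/esym/eqP.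
  have : \sum_i (a i)^-1 * `|2 * u i 0 - 0| == 0.
    by rewrite eq_le u1 sumr_ge0// => k _; rewrite mulr_ge0// ltW.
  rewrite psumr_eq0 => [/allP/(_ i)|k _]; last by rewrite mulr_ge0// ltW.
  rewrite mem_index_enum => /(_ isT); rewrite mulf_eq0 gt_eqF//=.
  by rewrite normr_eq0 subr0 mulf_eq0 pnatr_eq0.
exists (t^-1 *: u); last by rewrite scalerA divff ?scale1r// gt_eqF.
rewrite /std_cross /=.
have -> : wabs (t^-1 *: u) = t^-1 * \sum_i (a i)^-1 * `|2 * u i 0 - t|.
  rewrite mulr_sumr; apply: eq_bigr => i _; rewrite [RHS]mulrCA; congr (_ * _).
  rewrite -[X in X * `|_|](@gtr0_norm _ t^-1) ?invr_gt0// -normrM mxE.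
  by congr `|_|; field; rewrite gt_eqF.
by rewrite mulrC ler_pdivrMr// mul1r.
Qed.

(** With [y = 2 (r + t f) - t], let [d] be the difference of [y] and its nearest
    even integer, which is [2 u - t] for a lattice translate [u] of [r + t f].
    The nearest odd integer is at distance [1 - |d|], which is the corresponding
    quantity for [z - u] and [1 - t].  Both dilate conditions thus say that the
    weighted sum of the distances equals [t], and the continuity of that sum, with
    values between 0 and 1, provides such a [t]. *)
Lemma std_cross_covering f : spindle_covering std_cross f.
Proof.
move=> r; pose y i t := 2 * (r i 0 + t * f i 0) - t.
pose h t := \sum_i (a i)^-1 * `|y i t - nearest_even (y i t)|.
have yc i : continuous (y i).
  move=> t; apply: cvgB; last exact: cvg_id.
  apply: cvgMl_tmp; apply: cvgD; first exact: cvg_cst.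
  by apply: cvgMr_tmp; exact: cvg_id.
have hc : continuous h.
  apply: continuous_wsum => i t.
  apply: (@continuous_comp _ _ _ (y i) (fun v : R => `|v - nearest_even v|)).
    exact: yc.
  exact: even_distance_continuous.
have h0 t : 0 <= h t by apply: sumr_ge0 => i _; rewrite mulr_ge0// ltW.
have h1 t : h t <= 1.
  rewrite -[leRHS]a_sum; apply: ler_sum => i _.
  by rewrite ler_piMr ?nearest_even_dist// ltW.
have [t /[!in_itv]/= t01 ht] : exists2 t, t \in `[0, 1] & h t - t = 0.
  apply: IVT => //.
    apply: continuous_subspaceT => t; apply: cvgB; [exact: hc | exact: cvg_id].
  by rewrite ge_min le_max !subr_le0 !subr_ge0 h1 h0 orbT.
have {ht} ht : h t = t by apply/eqP; rewrite -subr_eq0 ht.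
have [t0 t1] := andP t01.
pose k i := Num.floor ((y i t + 1) / 2).
pose d i := y i t - nearest_even (y i t).
pose w : 'cV[R]_n := \col_i - (k i)%:~R.
(* [2 z - 1] is the odd integer nearest to [d]. *)
pose z : 'cV[R]_n := \col_i (0 <= d i)%R%:R.
exists t, (r + w + t *: f), w, z; split=> //.
- by apply/integer_latticeP => i; rewrite mxE rpredN intr_int.
- by apply/integer_latticeP => i; rewrite mxE natr_int.
have uE i : 2 * (r + w + t *: f) i 0 - t = d i.
  by rewrite /d /nearest_even -/(k i) /y !mxE; ring.
have zuE i : `|2 * (z - (r + w + t *: f)) i 0 - (1 - t)| = 1 - `|d i|.
  have -> : 2 * (z - (r + w + t *: f)) i 0 - (1 - t) =
      2 * z i 0 - 1 - (2 * (r + w + t *: f) i 0 - t) by rewrite !mxE; ring.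
  rewrite uE mxE; have := nearest_even_dist (y i t); rewrite -/(d i).
  have [d0|d0] := leP 0 (d i).
    by rewrite (ger0_norm d0) mulr1n => d1; rewrite ger0_norm; lra.
  by rewrite (ltr0_norm d0) mulr0n => d1; rewrite ler0_norm; lra.
split; apply: std_cross_scale; rewrite ?subr_ge0//.
  by under eq_bigr do rewrite uE; rewrite -/(h t) ht.
under eq_bigr do rewrite zuE mulrBr mulr1.
by rewrite sumrB a_sum -/(h t) ht.
Qed.

Lemma cross_polytope_unique_lifting : unique_lifting_property
  [set x + const_mx 2^-1 | x in convex_hull vertices].
Proof.
have lf := std_cross_lattice_free.
split.
- rewrite convex_hull_translate.
  exists [set x + const_mx 2^-1 | x in vertices] => //; apply: finite_image.
  by rewrite finite_setU; split; exact: finite_image.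
- rewrite std_crossE; apply: maximal_lattice_free_blocked => //.
  exact: std_cross_blocked.
rewrite std_crossE => f Bf; have [_ _ cB iB] := lf.
apply: unique_minimal_lifting_of_covering => //.
exact: std_cross_covering.
Qed.

End CrossPolytope.

(** * Unique lifting *)

Theorem corollary5p7 (R : realType) (n : nat) (a : 'I_n -> R)
    (a_gt0 : forall i, 0 < a i) (a_sum : \sum_(i < n) (a i)^-1 = 1) :
  unique_lifting_property
    (convex_hull ([set 0] `|` [set a i *: unit_vec R i | i in [set: 'I_n]]))
  /\
  unique_lifting_property
    [set x + const_mx 2^-1 | x in
      convex_hull ([set (a i / 2) *: unit_vec R i | i in [set: 'I_n]] `|`
            [set - (a i / 2) *: unit_vec R i | i in [set: 'I_n]])].
Proof.
by split; [exact: simplex_unique_lifting | exact: cross_polytope_unique_lifting].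
Qed.
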